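(* There is no von Neumann regular ring $R$ with finite stable rank such that $S_{\omega_1}$ is isomorphic to the semilattice of all compact ideals of $R$.
   Context: Rings are associative and unital. Ideals are two-sided; a compact ideal is a finitely generated (two-sided) ideal, and the compact ideals of $R$ form a join-semilattice with zero under inclusion (join is the sum of ideals). Finite stable rank means finite Bass stable rank. For von Neumann regular rings (more generally exchange rings), $R$ has stable rank at most $k$ iff the isomorphism class $e=[R]$ has stable rank at most $k$ in the commutative monoid $V(R)$ of isomorphism classes of finitely generated projective right $R$-modules (addition induced by direct sum), i.e. $ke+a=e+b$ implies $a\leq b$ for all $a,b\in V(R)$, where $x\leq y$ iff $x+z=y$ for some $z\in V(R)$. Here $k$ is a positive integer. The semilattice $S_{\omega_1}$: ordinals are identified with the set of smaller ordinals. Let $\mathcal{B}_{\omega_1}$ be the Boolean subalgebra of the powerset of $\omega_1$ generated by all intervals of $\omega_1$. Put $\mathcal{I}_{\omega_1}=\{x\in\mathcal{B}_{\omega_1}\mid \exists\alpha<\omega_1,\ x\subseteq\alpha\}$, $\mathcal{F}_{\omega_1}=\{x\in\mathcal{B}_{\omega_1}\mid \exists\alpha<\omega_1,\ \omega_1\setminus\alpha\subseteq x\}$, $D_{\omega_1}=\{x\subseteq\omega_1\mid x\text{ is finite or }x=\omega_1\}$, and $D_{\omega_1}^-=D_{\omega_1}\setminus\{\varnothing\}$. Then $S_{\omega_1}=(\{\varnothing\}\times\mathcal{I}_{\omega_1})\cup(D_{\omega_1}^-\times\mathcal{F}_{\omega_1})$, ordered by componentwise inclusion; it is a distributive join-semilattice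 with $0$ and $1$ (joins are componentwise unions). *)

(* Defs.v *)
From HB Require Import structures.
From mathcomp Require Import all_boot all_order all_algebra.
From mathcomp Require Import boolp classical_sets functions cardinality.
From mathcomp Require Import set_interval.
From mathcomp Require wochoice.

Set Implicit Arguments.
Unset Strict Implicit.
Unset Printing Implicit Defensive.

Import Order.TTheory GRing.Theory.

Local Open Scope classical_set_scope.
Local Open Scope ring_scope.

(* Rings are [pzRingType]s: associative and unital, not assumed commutative,
   possibly zero. *)

Definition von_neumann_regular (R : pzRingType) : Prop :=
  forall x : R, exists y : R, x * y * x = x.

Definition right_unimodular (R : pzRingType) (n : nat) (a : 'I_n -> R) : Prop :=
  exists x : 'I_n -> R, \sum_(i < n) a i * x i = 1.

(* Bass stable rank at most [k]: every unimodular row of length [k + 1]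
   can be shortened to a unimodular row of length [k]. *)
Definition stable_rank_le (R : pzRingType) (k : nat) : Prop :=
  forall a : 'I_k.+1 -> R, right_unimodular a ->
  exists b : 'I_k -> R,
    right_unimodular (fun i : 'I_k => a (lift ord_max i) + a ord_max * b i).

Definition finite_stable_rank (R : pzRingType) : Prop :=
  exists2 k : nat, (0 < k)%N & stable_rank_le R k.

Definition two_sided_ideal (R : pzRingType) (I : set R) : Prop :=
  [/\ I 0,
      (forall x y, I x -> I y -> I (x + y)),
      (forall r x, I x -> I (r * x)) &
      (forall r x, I x -> I (x * r))].

Definition ideal_span (R : pzRingType) (A : set R) : set R :=
  smallest (@two_sided_ideal R) A.

Definition is_compact_ideal (R : pzRingType) (I : set R) : Prop :=
  exists s : seq R, I = ideal_span [set` s].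

Definition ideal_sum (R : pzRingType) (I J : set R) : set R :=
  [set z | exists x y, [/\ I x, J y & z = x + y]].

Definition compact_ideal (R : pzRingType) : Type :=
  set_type [set I : set R | is_compact_ideal I].
HB.instance Definition _ (R : pzRingType) := Choice.on (compact_ideal R).

Fact compact_ideal_display : Order.disp_t. Proof. exact: (Order.Disp tt tt). Qed.

Section CompactIdeals.
Variable R : pzRingType.
Implicit Types (I J : set R) (x y z : compact_ideal R).

Lemma ideal_span_ideal A : two_sided_ideal (@ideal_span R A).
Proof.
split.
- by move=> I [[]].
- by move=> x y hx hy I [hI AI]; case: (hI) => _ + _ _; apply; [apply: hx|apply: hy].
- by move=> r x hx I [hI AI]; case: (hI) => _ _ + _; apply; apply: hx.
- by move=> r x hx I [hI AI]; case: (hI) => _ _ _; apply; apply: hx.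
Qed.

Lemma ideal_span_sub A I :
  two_sided_ideal I -> A `<=` I -> ideal_span A `<=` I.
Proof. by move=> hI AI; apply: smallest_sub. Qed.

Lemma ideal_sum_ideal I J :
  two_sided_ideal I -> two_sided_ideal J -> two_sided_ideal (ideal_sum I J).
Proof.
move=> [I0 ID IMl IMr] [J0 JD JMl JMr]; split.
- by exists 0, 0; rewrite addr0.
- move=> _ _ [x [y [Ix Jy ->]]] [x' [y' [Ix' Jy' ->]]].
  by exists (x + x'), (y + y'); rewrite addrACA; split; auto.
- by move=> r _ [x [y [Ix Jy ->]]]; exists (r * x), (r * y); rewrite mulrDr; split; auto.
- by move=> r _ [x [y [Ix Jy ->]]]; exists (x * r), (y * r); rewrite mulrDl; split; auto.
Qed.

Lemma ideal_sum_subP I J K :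
  two_sided_ideal I -> two_sided_ideal J -> two_sided_ideal K ->
  ideal_sum I J `<=` K <-> I `<=` K /\ J `<=` K.
Proof.
move=> [I0 _ _ _] [J0 _ _ _] [_ KD _ _]; split=> [s|[sI sJ] _ [x [y [Ix Jy ->]]]].
  split=> x hx; apply: s; first by exists x, 0; rewrite addr0.
  by exists 0, x; rewrite add0r.
by apply: KD; auto.
Qed.

Lemma ideal_sum_compact I J :
  is_compact_ideal I -> is_compact_ideal J -> is_compact_ideal (ideal_sum I J).
Proof.
move=> [s ->] [t ->]; exists (s ++ t).
have hs := ideal_span_ideal [set` s]; have ht := ideal_span_ideal [set` t].
have hst := ideal_span_ideal [set` s ++ t].
apply/seteqP; split.
  apply/ideal_sum_subP => //; split; apply: ideal_span_sub => // x /= xs;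
    by apply: (@sub_gen_smallest _ _ [set` s ++ t]); rewrite /= mem_cat xs ?orbT.
apply: ideal_span_sub; first exact: ideal_sum_ideal.
move=> x /=; rewrite mem_cat => /orP[] h.
  exists x, 0; rewrite addr0; split=> //; last by case: ht.
  exact: (@sub_gen_smallest _ _ [set` s]).
exists 0, x; rewrite add0r; split=> //; first by case: hs.
exact: (@sub_gen_smallest _ _ [set` t]).
Qed.

Lemma zero_ideal_compact : is_compact_ideal [set (0 : R)].
Proof.
exists [::]; apply/seteqP; split.
  by move=> _ ->; case: (ideal_span_ideal [set` [::]]).
apply: ideal_span_sub => //; split=> //.
- by move=> _ _ -> ->; rewrite /= addr0.
- by move=> r _ ->; rewrite /= mulr0.
- by move=> r _ ->; rewrite /= mul0r.
Qed.

Lemma compact_idealP x : is_compact_ideal (val x).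
Proof. exact: set_mem (valP x). Qed.

Lemma compact_ideal_ideal x : two_sided_ideal (val x).
Proof. by case: (compact_idealP x) => s ->; apply: ideal_span_ideal. Qed.

Definition compact_ideal_le x y : bool := `[< val x `<=` val y >].

Lemma compact_ideal_le_refl : reflexive compact_ideal_le.
Proof. by move=> x; apply/asboolP. Qed.

Lemma compact_ideal_le_anti : antisymmetric compact_ideal_le.
Proof.
by move=> x y /andP[/asboolP xy /asboolP yx]; apply/val_inj/seteqP.
Qed.

Lemma compact_ideal_le_trans : transitive compact_ideal_le.
Proof.
move=> y x z /asboolP xy /asboolP yz; apply/asboolP; exact: subset_trans yz.
Qed.

HB.instance Definition _ :=
  Order.Le_isPOrder.Build compact_ideal_display (compact_ideal R)
    compact_ideal_le_refl compact_ideal_le_anti compact_ideal_le_trans.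

Definition compact_ideal_join x y : compact_ideal R :=
  exist _ (ideal_sum (val x) (val y))
    (mem_set (ideal_sum_compact (compact_idealP x) (compact_idealP y))).

Lemma compact_ideal_leUx x y z :
  (compact_ideal_join x y <= z)%O = (x <= z)%O && (y <= z)%O.
Proof.
apply/asboolP/andP => [/ideal_sum_subP[]|[/asboolP ? /asboolP ?]];
  try exact: compact_ideal_ideal.
- by move=> ? ?; split; apply/asboolP.
- by apply/ideal_sum_subP => //; exact: compact_ideal_ideal.
Qed.

HB.instance Definition _ :=
  Order.POrder_isJoinSemilattice.Build compact_ideal_display (compact_ideal R)
    compact_ideal_leUx.

Definition compact_ideal_bot : compact_ideal R :=
  exist _ [set 0] (mem_set zero_ideal_compact).

Lemma compact_ideal_le0x x : (compact_ideal_bot <= x)%O.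
Proof.
by apply/asboolP => _ /= ->; case: (compact_ideal_ideal x).
Qed.

HB.instance Definition _ :=
  Order.hasBottom.Build compact_ideal_display (compact_ideal R)
    compact_ideal_le0x.

End CompactIdeals.

Definition segment (d : Order.disp_t) (W : orderType d) (a : W) : set W :=
  [set b | (b < a)%O].

(* The well-ordered set omega_1 is determined up to a unique isomorphism by
   these axioms.  The element [a] stands for the ordinal [segment a].  A
   concrete copy is built at the end of the file. *)
HB.mixin Record isOmega1 (d : Order.disp_t) W of Order.Total d W := {
  omega1_wf : well_founded (fun x y : W => (x < y)%O);
  omega1_uncountable : ~ countable [set: W];
  omega1_countable_segment : forall a : W, countable (segment a)
}.

#[short(type="omega1Type")]
HB.structure Definition Omega1 d := { W of Order.Total d W & isOmega1 d W }.

Definition boolean_subalgebra (T : Type) (G : set (set T)) : Prop :=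
  [/\ G set0,
      (forall x, G x -> G (~` x)) &
      (forall x y, G x -> G y -> G (x `|` y))].

Section SOmega1.
Variables (d : Order.disp_t) (W : omega1Type d).
Implicit Type x : set W.

Definition B_omega1 : set (set W) :=
  smallest (@boolean_subalgebra W) [set x | exists i : interval W, x = [set` i]].

Definition I_omega1 : set (set W) :=
  [set x | B_omega1 x /\ exists a : W, x `<=` segment a].

Definition F_omega1 : set (set W) :=
  [set x | B_omega1 x /\ exists a : W, ~` segment a `<=` x].

Definition D_omega1 : set (set W) :=
  [set x | finite_set x \/ x = [set: W]].

Definition Dminus_omega1 : set (set W) := D_omega1 `\ set0.

Definition S_omega1_set : set (set W * set W) :=
  ([set set0] `*` I_omega1) `|` (Dminus_omega1 `*` F_omega1).

Definition S_omega1 : Type := set_type S_omega1_set.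
HB.instance Definition _ := Choice.on S_omega1.

End SOmega1.

Fact S_omega1_display : Order.disp_t. Proof. exact: (Order.Disp tt tt). Qed.

Section SOmega1Semilattice.
Variables (d : Order.disp_t) (W : omega1Type d).
Implicit Types (p q r : set W * set W) (x y z : S_omega1 W).

Lemma B_omega1_algebra : boolean_subalgebra (@B_omega1 d W).
Proof.
split.
- by move=> G [[]].
- by move=> x hx G [hG iG]; case: (hG) => _ + _; apply; apply: hx.
- by move=> x y hx hy G [hG iG]; case: (hG) => _ _; apply; [apply: hx|apply: hy].
Qed.

Definition pair_union p q : set W * set W := (p.1 `|` q.1, p.2 `|` q.2).

Lemma S_omega1_setU p q :
  S_omega1_set p -> S_omega1_set q -> S_omega1_set (pair_union p q).
Proof.
have [_ _ BU] := B_omega1_algebra.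
have FU (u v : set W) : F_omega1 u -> B_omega1 v -> F_omega1 (u `|` v).
  by move=> [Bu [a ua]] Bv; split; [exact: BU|exists a => b /ua; left].
case: p q => [p1 p2] [q1 q2] /= [[/= -> Ip]|[/= [Dp p0] Fp]] [[/= -> Iq]|[/= [Dq q0] Fq]].
- left; split=> /=; first by rewrite setU0.
  case: Ip Iq => [Bp [a pa]] [Bq [b qb]]; split; first exact: BU.
  exists (Order.max a b) => c; rewrite /segment /= lt_max.
  by case=> [/pa|/qb] /= ->; rewrite ?orbT.
- right; split=> /=; first by rewrite set0U; split.
  by rewrite setUC; apply: FU => //; case: Ip.
- right; split=> /=; first by rewrite setU0; split.
  by apply: FU => //; case: Iq.
- right; split=> /=; last by apply: FU => //; case: Fq.
  split; last by move=> /= h0; apply: p0 => /=; rewrite -subset0 -h0; exact: subsetUl.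
  case: Dp => [fp|->]; last by right; rewrite setTU.
  case: Dq => [fq|->]; last by right; rewrite setUT.
  by left; rewrite finite_setU.
Qed.

Lemma S_omega1_set0 : S_omega1_set (set0 : set W, set0 : set W).
Proof.
have [B0 _ _] := B_omega1_algebra.
have [a _] : [set: W] !=set0.
  by apply/set0P/eqP => W0; apply: (@omega1_uncountable _ W); rewrite W0.
by left; split=> //=; split=> //; exists a => b.
Qed.

Definition S_omega1_le x y : bool :=
  `[< (val x).1 `<=` (val y).1 /\ (val x).2 `<=` (val y).2 >].

Lemma S_omega1_le_refl : reflexive S_omega1_le.
Proof. by move=> x; apply/asboolP; split. Qed.

Lemma S_omega1_le_anti : antisymmetric S_omega1_le.
Proof.
move=> x y /andP[/asboolP[xy1 xy2] /asboolP[yx1 yx2]]; apply/val_inj.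
rewrite [val x]surjective_pairing [val y]surjective_pairing.
by congr pair; apply/seteqP.
Qed.

Lemma S_omega1_le_trans : transitive S_omega1_le.
Proof.
move=> y x z /asboolP[xy1 xy2] /asboolP[yz1 yz2]; apply/asboolP.
by split; [exact: subset_trans yz1|exact: subset_trans yz2].
Qed.

HB.instance Definition _ :=
  Order.Le_isPOrder.Build S_omega1_display (S_omega1 W)
    S_omega1_le_refl S_omega1_le_anti S_omega1_le_trans.

Definition S_omega1_join x y : S_omega1 W :=
  exist _ (pair_union (val x) (val y))
    (mem_set (S_omega1_setU (set_mem (valP x)) (set_mem (valP y)))).

Lemma S_omega1_leUx x y z :
  (S_omega1_join x y <= z)%O = (x <= z)%O && (y <= z)%O.
Proof.
apply/asboolP/andP => /= [[]|[/asboolP[? ?] /asboolP[? ?]]].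
- by rewrite !subUset => -[? ?] [? ?]; split; apply/asboolP.
- by rewrite !subUset.
Qed.

HB.instance Definition _ :=
  Order.POrder_isJoinSemilattice.Build S_omega1_display (S_omega1 W)
    S_omega1_leUx.

Definition S_omega1_bot : S_omega1 W :=
  exist _ (set0, set0) (mem_set S_omega1_set0).

Lemma S_omega1_le0x x : (S_omega1_bot <= x)%O.
Proof. by apply/asboolP; split. Qed.

HB.instance Definition _ :=
  Order.hasBottom.Build S_omega1_display (S_omega1 W) S_omega1_le0x.

End SOmega1Semilattice.

Definition isomorphic_semilattices (d d' : Order.disp_t)
    (S : bJoinSemilatticeType d) (T : bJoinSemilatticeType d') : Prop :=
  exists f : S -> T,
    [/\ bijective f,
        f \bot%O = \bot%O &
        {morph f : x y / (x `|` y)%O}].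

(* A copy of omega_1: the elements with countably many predecessors in a
   well-ordering of the power set of [nat]. *)
Module OmegaOne.

Local Notation T := (set nat).

Definition R : rel T := projT1 (wochoice.well_ordering_principle T).

Lemma R_wo : wochoice.well_order R.
Proof. exact: (projT2 (wochoice.well_ordering_principle T)). Qed.

Lemma R_min (A : set T) : A !=set0 -> exists2 z, A z & forall x, A x -> R z x.
Proof.
move=> [x Ax]; have [|z [[Az zA] _]] := @R_wo (mem A).
  by exists x; apply/mem_set.
exists z; first exact: set_mem.
by move=> y Ay; apply: zA; apply/mem_set.
Qed.

Lemma R_anti : antisymmetric R.
Proof.
have wo : wochoice.wo_chain R predT.
  exact: (wochoice.withinW (A := predT) R_wo).
by move=> x y; exact: (wochoice.wo_chain_antisymmetric wo).
Qed.

Lemma R_total : total R.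
Proof.
move=> x y; have [|z zxy zP] := @R_min [set x; y]; first by exists x; left.
have zx : R z x by apply: zP; left.
have zy : R z y by apply: zP; right.
by case: zxy zx zy => ->; [move=> _ ->|move=> ->; rewrite orbT].
Qed.

Lemma R_trans : transitive R.
Proof.
move=> y x z xy yz; have [|t txyz tP] := @R_min [set x; y; z].
  by exists x; do 2!left.
have tx : R t x by apply: tP; do 2!left.
have ty : R t y by apply: tP; left; right.
have tz : R t z by apply: tP; right.
case: txyz tx ty tz => [[->|->]|->] // tx ty tz.
- by rewrite (R_anti (x := x) (y := y)) ?xy.
- by rewrite -(R_anti (x := y) (y := z)) ?yz.
Qed.

Definition below (A : T) : set T := [set B | R B A /\ B <> A].

Definition W : Type := set_type [set A : T | countable (below A)].
HB.instance Definition _ := Choice.on W.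

Definition le (x y : W) : bool := R (val x) (val y).

Fact display : Order.disp_t. Proof. exact: (Order.Disp tt tt). Qed.

Lemma le_refl : reflexive le.
Proof. by move=> x; have := R_total (val x) (val x); rewrite orbb. Qed.

Lemma le_anti : antisymmetric le.
Proof. by move=> x y /R_anti/val_inj. Qed.

Lemma le_trans : transitive le.
Proof. by move=> y x z; apply: R_trans. Qed.

Lemma le_total : total le.
Proof. by move=> x y; apply: R_total. Qed.

HB.instance Definition _ :=
  Order.Le_isPOrder.Build display W le_refl le_anti le_trans.
HB.instance Definition _ := Order.POrder_isTotal.Build display W le_total.

Lemma wf : well_founded (fun x y : W => (x < y)%O).
Proof.
move=> a; apply: contrapT => na.
have [|_ [z nz <-] zP] := @R_min (val @` [set x : W | ~ Acc (fun x y => (x < y)%O) x]).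
  by exists (val a), a.
apply: nz; constructor=> y yz; apply: contrapT => ny.
have : (z <= y)%O by apply: zP; exists y.
by rewrite leNgt yz.
Qed.

Lemma powerset_uncountable : ~ countable [set: T].
Proof.
move=> /countable_injP[f finj].
pose D : T := [set n | exists2 A : T, f A = n & ~ A n].
have [Df|nDf] := pselect (D (f D)); last by apply: (nDf); exists D.
by have [A /finj-> //] := Df; rewrite inE.
Qed.

Lemma uncountable : ~ countable [set: W].
Proof.
move=> cW; pose C := [set A : T | countable (below A)].
have cC : countable C.
  rewrite (_ : C = val @` [set: W]); first by apply: sub_countable cW; exact: card_image_le.
  apply/seteqP; split=> [A CA|_ [x _ <-]]; last exact: set_mem (valP x).
  by exists (exist _ A (mem_set CA)).
have [|z nz zP] := @R_min (~` C).
  apply/set0P/eqP => nC; apply: powerset_uncountable.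
  by rewrite -(setCK [set: T]) setCT -nC setCK.
apply: nz; rewrite /C /=; apply: sub_countable cC; apply: subset_card_le.
move=> B [RBz Bz]; apply: contrapT => /zP RzB.
by apply: Bz; apply: R_anti; rewrite RBz.
Qed.

Lemma countable_segment (a : W) : countable (segment a).
Proof.
have ca : countable (below (val a)) by exact: set_mem (valP a).
have vinj : {in segment a &, injective (val : W -> T)}.
  by move=> x y _ _; apply: val_inj.
rewrite -(eq_countable (inj_card_eq vinj)); apply: sub_countable ca.
apply: subset_card_le => _ [b ba <-]; split; first exact: ltW ba.
by move=> /val_inj e; move: ba; rewrite /segment /= e ltxx.
Qed.

HB.instance Definition _ :=
  isOmega1.Build display W wf uncountable countable_segment.

Definition omega1 : omega1Type display := W.

End OmegaOne.

(* Main.v *)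
Require Import Defs.
From mathcomp Require Import all_boot all_order all_algebra.
From mathcomp Require Import boolp classical_sets functions cardinality.
From mathcomp Require Import set_interval.

Set Implicit Arguments.
Unset Strict Implicit.
Unset Printing Implicit Defensive.

Import Order.TTheory GRing.Theory.

Local Open Scope classical_set_scope.
Local Open Scope ring_scope.

(** Write a pair [(D, F)] of the semilattice also for the corresponding compact
    ideal.  For a point [x] let [g x] generate [({x}, omega_1)].  For every [e]
    the ideal [J_e = (omega_1, omega_1 - {e})] is proper and, together with
    [g x], generates [R]; so [1] is congruent modulo [J_e] to a sum of some
    number of terms [r * g x * s].  That number can be chosen independently of
    [e], since the ideals [(omega_1, omega_1 - alpha)] are countably downward
    directed and [J_e] contains all of them with [alpha > e].  By uncountability
    some number [N] works for infinitely many [x]; take [m] of these, [m] large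
    with respect to [N] and to the stable rank.  The right ideals [g x R] can be
    made independent at the cost of error terms lying in the intersection of
    [({x}, omega_1)] with the sum of the ideals of other points: the compact
    ideals of the error terms have empty first component, hence are of the form
    [(0, F)] with [F] bounded, and they lie in [J_e] for [e] large.  Modulo such
    a [J_e] the module [R^m] is a direct summand of [R^N], which contradicts
    finite stable rank.  To avoid quotient rings, all matrix identities are
    written as congruences in [R] modulo [J_e]. *)

(** * Matrix congruences modulo an ideal, and stable rank *)

Section Ideals.
Variables (R : pzRingType) (J : set R).
Hypothesis idJ : two_sided_ideal J.

Let J0 : J 0. Proof. by case: idJ. Qed.

Let JD x y : J x -> J y -> J (x + y). Proof. by case: idJ => _ + _ _; apply. Qed.

Let JMl r x : J x -> J (r * x). Proof. by case: idJ => _ _ + _; apply. Qed.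

Let JMr r x : J x -> J (x * r). Proof. by case: idJ => _ _ _; apply. Qed.

Lemma ideal_opp x : J x -> J (- x).
Proof. by move=> Jx; rewrite -mulN1r; apply: JMl. Qed.

Lemma ideal_sub x y : J x -> J y -> J (x - y).
Proof. by move=> Jx Jy; apply: JD => //; apply: ideal_opp. Qed.

Lemma ideal_bigsum (I : Type) (s : seq I) (P : pred I) (F : I -> R) :
  (forall i, P i -> J (F i)) -> J (\sum_(i <- s | P i) F i).
Proof. exact: (big_ind J). Qed.

Definition mx_in m n (M : 'M[R]_(m, n)) : Prop := forall i j, J (M i j).

Lemma mx_in_add m n (M N : 'M[R]_(m, n)) : mx_in M -> mx_in N -> mx_in (M + N).
Proof. by move=> hM hN i j; rewrite mxE; apply: JD. Qed.

Lemma mx_in_opp m n (M : 'M[R]_(m, n)) : mx_in M -> mx_in (- M).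
Proof. by move=> hM i j; rewrite mxE; apply: ideal_opp. Qed.

Lemma mx_in_mull m n p (N : 'M[R]_(m, n)) (M : 'M[R]_(n, p)) :
  mx_in M -> mx_in (N *m M).
Proof. by move=> hM i j; rewrite mxE; apply: ideal_bigsum => l _; apply: JMl. Qed.

Lemma mx_in_mulr m n p (N : 'M[R]_(n, p)) (M : 'M[R]_(m, n)) :
  mx_in M -> mx_in (M *m N).
Proof. by move=> hM i j; rewrite mxE; apply: ideal_bigsum => l _; apply: JMr. Qed.

(* The row [(x, 1 - x t)] is unimodular. *)
Lemma stable_rank_row k (x : 'rV[R]_k) (t : 'cV[R]_k) : stable_rank_le R k ->
  exists (b : 'rV[R]_k) (y : 'cV[R]_k), (x + (1%:M - x *m t) *m b) *m y = 1%:M.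
Proof.
pose c := (1%:M - x *m t) 0 0.
pose a (i : 'I_k.+1) := if unlift ord_max i is Some j then x 0 j else c.
have aM : a ord_max = c by rewrite /a unlift_none.
have aL j : a (lift ord_max j) = x 0 j by rewrite /a liftK.
have wl j : widen_ord (leqnSn k) j = lift ord_max j.
  by apply: val_inj; rewrite /= /bump leqNgt ltn_ord.
case/(_ a).
  exists (fun i => if unlift ord_max i is Some j then t j 0 else 1).
  rewrite big_ord_recr /= aM unlift_none mulr1.
  under eq_bigr do rewrite wl aL liftK.
  by rewrite /c !mxE eqxx mulr1n addrC subrK.
move=> b [y]; rewrite aM => bE.
exists (\row_j b j), (\col_j y j); apply/matrixP => i j.
rewrite !ord1 mxE [RHS]mxE eqxx mulr1n -[RHS]bE; apply: eq_bigr => l _.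
by rewrite aL !mxE big_ord1 !mxE /c !mxE.
Qed.

(* Shortening the first row of [X] by the stable rank condition amounts to a
   column operation turning its first [k] entries into a unimodular row; the
   remaining entries of the row are then cleared by column operations. *)
Lemma stable_rank_reduce k m n (A : 'M[R]_(k + m, 1 + n))
    (X : 'M[R]_(1 + n, k + m)) :
  stable_rank_le R k -> mx_in (A *m X - 1%:M) ->
  exists (B : 'M[R]_(m, n)) (Y : 'M[R]_(n, m)), mx_in (B *m Y - 1%:M).
Proof.
move=> srR; rewrite -[A]vsubmxK -[X]hsubmxK.
set Au := usubmx A; set Al := dsubmx A; set Xu := lsubmx X; set Xl := rsubmx X.
rewrite mul_col_row scalar_mx_block opp_block_mx add_block_mx !oppr0 !addr0 => AX.
have uu : mx_in (Au *m Xu - 1%:M).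
  by move=> i j; move: (AX (lshift m i) (lshift m j)); rewrite block_mxEul.
have ul : mx_in (Au *m Xl).
  by move=> i j; move: (AX (lshift m i) (rshift k j)); rewrite block_mxEur.
have lu : mx_in (Al *m Xu).
  by move=> i j; move: (AX (rshift k i) (lshift m j)); rewrite block_mxEdl.
have ll : mx_in (Al *m Xl - 1%:M).
  by move=> i j; move: (AX (rshift k i) (rshift k j)); rewrite block_mxEdr.
pose e : 'cV[R]_(1 + n) := col_mx 1%:M 0.
have [b [y yE]] := stable_rank_row (usubmx Xu) (Au *m e) srR.
pose P := Au *m e.
pose D := Au *m Xu - 1%:M.
(* Modulo [J], [Au] kills the column [e - Xu *m P], so [Au *m Z] stays congruent to [1%:M]. The top
   entry of this column is the [1 - x t] of [stable_rank_row], so the top row of [Z] is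
   unimodular. *)
pose Z := Xu + (e - Xu *m P) *m b.
have ZE : usubmx Z = usubmx Xu + (1%:M - usubmx Xu *m P) *m b.
  by rewrite /Z raddfD /= -mul_usub_mx raddfB /= -mul_usub_mx col_mxKu.
(* Since [Al *m Z] is congruent to [Al *m e *m b], this correction makes [B *m Z] vanish modulo [J];
   clearing the top row of [Xl] by columns of [Z] then does not affect the product with [B]. *)
pose B := Al - Al *m e *m b *m Au.
pose Y := Xl - Z *m y *m usubmx Xl.
have Y0 : usubmx Y = 0.
  by rewrite /Y raddfB /= -!mul_usub_mx ZE yE mul1mx subrr.
exists (rsubmx B), (dsubmx Y).
have -> : rsubmx B *m dsubmx Y = B *m Y.
  by rewrite -[in RHS](hsubmxK B) -[in RHS](vsubmxK Y) Y0 mul_row_col mulmx0 add0r.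
have AlZ : Al *m Z = Al *m Xu - Al *m Xu *m (P *m b) + Al *m e *m b.
  by rewrite mulmxDr !mulmxA mulmxBr mulmxBl !mulmxA -addrA [- _ + _]addrC.
have AuZ : Au *m Z = 1%:M + (D - D *m (P *m b)).
  have AXu : Au *m Xu = 1%:M + D by rewrite addrC subrK.
  rewrite mulmxDr (mulmxA Au) mulmxBr (mulmxA Au) AXu -/P (mulmxDl _ _ P) mul1mx.
  by rewrite opprD [P + _]addrA subrr sub0r mulNmx -mulmxA -addrA.
have BZ : mx_in (B *m Z).
  have -> : B *m Z = Al *m Xu - Al *m Xu *m (P *m b)
                     - Al *m e *m b *m (D - D *m (P *m b)).
    rewrite mulmxBl AlZ -[_ *m Au *m Z]mulmxA AuZ mulmxDr mulmx1 opprD addrA.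
    by rewrite addrK.
  apply: mx_in_add; last apply/mx_in_opp/mx_in_mull;
    by apply: mx_in_add => //; apply/mx_in_opp/mx_in_mulr.
have -> : B *m Y - 1%:M = (Al *m Xl - 1%:M) - Al *m e *m b *m (Au *m Xl)
                          - B *m Z *m (y *m usubmx Xl).
  by rewrite mulmxBr {1}/B mulmxBl !mulmxA addrAC; congr (_ - _); rewrite addrAC.
apply: mx_in_add; last exact/mx_in_opp/mx_in_mulr.
by apply: mx_in_add => //; apply/mx_in_opp/mx_in_mull.
Qed.

(** Each reduction removes one column and [k] rows of [A]; after [n] of them the product is empty
    and the congruence puts [-1] in [J]. The number of rows is [n * k + 1], in the form that the
    induction unfolds. *)
Lemma stable_rank_ideal k n (A : 'M[R]_(iter n (addn k) 1%N, n))
    (X : 'M[R]_(n, iter n (addn k) 1%N)) :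
  stable_rank_le R k -> mx_in (A *m X - 1%:M) -> J 1.
Proof.
move=> srR; elim: n A X => [|n IHn] A X AX.
  move: (ideal_opp (AX ord0 ord0)); rewrite mulmx_sum_row.
  by rewrite !mxE big_ord0 !mxE eqxx sub0r opprK.
by have [B [Y /IHn]] := stable_rank_reduce srR AX.
Qed.

End Ideals.

(** * Idempotents and orthogonalization in regular rings *)

Section RegularRings.
Variable R : pzRingType.
Hypothesis regR : von_neumann_regular R.
Implicit Types (g b : R) (I : set R).

(** With [u := 1 - g], regularity makes [u * b * y] an idempotent fixing [u * b]; a further factor
    [u] on the right makes it orthogonal to [g]. Thus [g + h] is again idempotent, and a left unit
    for [b] as well. *)
Lemma idempotent_extension g b : g * g = g -> exists y h : R,
  [/\ h * h = h, g * h = 0, h * g = 0, h = (1 - g) * b * y * (1 - g)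
    & h * b = (1 - g) * b].
Proof.
move=> gg; pose u := 1 - g; have [y] := regR (u * b); rewrite !mulrA => xyx.
have uu : u * u = u by rewrite /u mulrBr mulr1 mulrBl mul1r gg subrr subr0.
have gu : g * u = 0 by rewrite mulrBr mulr1 gg subrr.
have ug : u * g = 0 by rewrite mulrBl mul1r gg subrr.
exists y, (u * b * y * u); split=> //.
- by rewrite !mulrA -[_ * u * u]mulrA uu xyx.
- by rewrite !mulrA gu !mul0r.
- by rewrite -[_ * u * g]mulrA ug mulr0.
Qed.

Lemma idempotent_left_unit (s : seq R) : exists g : R,
  [/\ g * g = g, forall x, x \in s -> g * x = x & ideal_span [set` s] g].
Proof.
elim: s => [|b s [g [gg gs sg]]].
  by exists 0; rewrite mul0r; split=> //; case: (ideal_span_ideal [set` ([::] : seq R)]).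
have [y [h [hh gh hg hE hb]]] := idempotent_extension b gg.
exists (g + h); split.
- by rewrite mulrDl !mulrDr gg gh hg hh addr0 add0r.
- move=> x; rewrite inE => /predU1P[->|xs].
    by rewrite mulrDl hb mulrBl mul1r addrC subrK.
  by rewrite mulrDl -{2}(gs x xs) mulrA hg mul0r addr0 gs.
- have idb := ideal_span_ideal [set` b :: s].
  have sub x : x \in b :: s -> ideal_span [set` b :: s] x.
    by move=> xs; apply: (@sub_gen_smallest _ _ [set` b :: s]).
  have [_ D Ml Mr] := idb; apply: D.
    apply: ideal_span_sub sg => // x xs; apply: sub.
    by rewrite inE; apply/orP; right.
  by rewrite hE; do 2!apply: (Mr); apply: Ml; apply: sub; apply: mem_head.
Qed.

Lemma compact_ideal_principal I : is_compact_ideal I ->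
  exists g : R, I = ideal_span [set g].
Proof.
move=> [s ->]; have [g [_ gs sg]] := idempotent_left_unit s; exists g.
apply/seteqP; split; apply: ideal_span_sub; try exact: ideal_span_ideal.
  move=> x xs; rewrite -(gs x xs); have [_ _ _ Mr] := ideal_span_ideal [set g].
  by apply: Mr; apply: (@sub_gen_smallest _ _ [set g]).
by move=> _ ->.
Qed.

(* Up to an error lying in [I_i :&: (I_0 + ... + I_(i-1))], where [I_i] is the
   ideal generated by [b i], the sum of the right ideals [b i R] is direct, and
   left multiplication by [f i] is the projection onto the [i]-th summand. *)
Lemma orthogonalization (b : nat -> R) (m : nat) : exists f c : nat -> R,
  (forall i j, (i < m)%N -> (j < m)%N -> f i * c j = c i *+ (i == j)) /\
  (forall i I, (i < m)%N -> two_sided_ideal I ->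
     I (b i) \/ (forall j, (j < i)%N -> I (b j)) -> I (b i - c i)).
Proof.
suff [f [c [g [_ _ _ fc bc]]]] : exists (f c : nat -> R) (g : R),
    [/\ g * g = g,
        forall I, two_sided_ideal I -> (forall i, (i < m)%N -> I (b i)) -> I g,
        forall i, (i < m)%N -> g * c i = c i,
        forall i j, (i < m)%N -> (j < m)%N -> f i * c j = c i *+ (i == j) &
        forall i I, (i < m)%N -> two_sided_ideal I ->
          I (b i) \/ (forall j, (j < i)%N -> I (b j)) -> I (b i - c i)].
  by exists f, c.
elim: m => [|m [f [c [g [gg gI gc fc bc]]]]].
  by exists (fun=> 0), (fun=> 0), 0; rewrite mul0r; split=> // I [].
have [y [h [hh gh hg hE hb]]] := idempotent_extension (b m) gg.
(* [C] lies in [b m R] and agrees with [b m] modulo [g R], which covers the two alternatives for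
   [I]. [F] fixes [C] and kills [g R], hence all earlier [c i]; subtracting [f i * F] makes the
   earlier [f i] kill [C]. *)
pose F := b m * y * h; pose C := b m * y * ((1 - g) * b m).
have hC : h * C = (1 - g) * b m.
  by rewrite /C !mulrA hb -hE hb.
have gbm : (g + h) * b m = b m by rewrite mulrDl hb mulrBl mul1r addrC subrK.
have FC : F * C = C by rewrite /F -mulrA hC.
have Fc i : (i < m)%N -> F * c i = 0.
  by move=> im; rewrite -(gc i im) mulrA /F -[_ * h * g]mulrA hg mulr0 mul0r.
exists (fun i => if (i < m)%N then f i - f i * F else F),
       (fun i => if (i < m)%N then c i else C), (g + h); split.
- by rewrite mulrDl !mulrDr gg gh hg hh addr0 add0r.
- move=> I idI bI; have [_ D Ml Mr] := idI; apply: D.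
    by apply: gI => // i im; apply: bI; apply: ltnW.
  by rewrite hE; do 2!apply: (Mr); apply: Ml; apply: bI.
- move=> i; rewrite ltnS leq_eqVlt => /predU1P[->|im]; last first.
    by rewrite im mulrDl -{2}(gc i im) mulrA hg mul0r addr0 gc.
  by rewrite ltnn /C !mulrA gbm.
- move=> i j; rewrite !ltnS [(i <= m)%N]leq_eqVlt [(j <= m)%N]leq_eqVlt.
  move=> /predU1P[->|im] /predU1P[->|jm].
  + by rewrite ltnn eqxx.
  + by rewrite ltnn jm Fc // gtn_eqF.
  + by rewrite ltnn im mulrBl -mulrA FC subrr ltn_eqF.
  + by rewrite im jm mulrBl -mulrA Fc // mulr0 subr0 fc.
- move=> i I; rewrite ltnS leq_eqVlt => /predU1P[->|im] idI; last first.
    by rewrite im; apply: bc.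
  have [_ _ Ml Mr] := idI; rewrite ltnn => -[bI|bI].
    by apply: ideal_sub => //; do 2!apply: (Ml).
  have -> : b m - C = g * (b m - C).
    apply/eqP; rewrite -subr_eq0 -{1}[b m - C]mul1r -mulrBl mulrBr subr_eq0.
    by rewrite /C !mulrA -hE hb.
  by apply: Mr; apply: gI.
Qed.

End RegularRings.

(** * Counting the terms needed to generate an element of a principal ideal *)

Section SandwichSums.
Variable R : pzRingType.
Implicit Types (g z : R).

Definition sandwich_sum g (n : nat) : set R :=
  [set z | exists r s : nat -> R, z = \sum_(l < n) r l * g * s l].

Lemma sandwich_sum_leq g n m z :
  (n <= m)%N -> sandwich_sum g n z -> sandwich_sum g m z.
Proof.
move=> nm [r [s ->]]; exists (fun l => if (l < n)%N then r l else 0), s.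
rewrite (big_ord_widen m (fun l => r l * g * s l)) // big_mkcond /=.
by apply: eq_bigr => l _; case: ifP; rewrite // !mul0r.
Qed.

Lemma sandwich_sum_add g n m y z : sandwich_sum g n y -> sandwich_sum g m z ->
  sandwich_sum g (n + m)%N (y + z).
Proof.
move=> [r [s ->]] [r' [s' ->]].
exists (fun l => if (l < n)%N then r l else r' (l - n)%N),
       (fun l => if (l < n)%N then s l else s' (l - n)%N).
rewrite big_split_ord /=; congr (_ + _); apply: eq_bigr => l _.
  by rewrite ltn_ord.
by rewrite ltnNge leq_addr /= addKn.
Qed.

Lemma ideal_span1_sandwich g z : ideal_span [set g] z ->
  exists n, sandwich_sum g n z.
Proof.
apply: (@ideal_span_sub R _ [set z | exists n, sandwich_sum g n z]); last first.
  by move=> _ ->; exists 1%N, (fun=> 1), (fun=> 1); rewrite big_ord1 mul1r mulr1.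
split.
- by exists 0%N, (fun=> 0), (fun=> 0); rewrite big_ord0.
- by move=> x y [n hx] [m hy]; exists (n + m)%N; apply: sandwich_sum_add.
- move=> t _ [n [r [s ->]]]; exists n, (fun l => t * r l), s.
  by rewrite mulr_sumr; apply: eq_bigr => l _; rewrite !mulrA.
- move=> t _ [n [r [s ->]]]; exists n, r, (fun l => s l * t).
  by rewrite mulr_suml; apply: eq_bigr => l _; rewrite !mulrA.
Qed.

(* Modulo [J], [R] is a direct summand of [(c i R)^n] for each [i]; as the sum of
   the [c i R] is direct, [R^m] is a direct summand of [R^n]. *)
Lemma stable_rank_orthogonal k n (J : set R) (b f c : nat -> R) :
  let m := iter n (addn k) 1%N in
  stable_rank_le R k -> two_sided_ideal J ->
  (forall i j, (i < m)%N -> (j < m)%N -> f i * c j = c i *+ (i == j)) ->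
  (forall i, (i < m)%N -> J (b i - c i)) ->
  (forall i, exists2 z, sandwich_sum (b i) n z & J (1 - z)) ->
  J 1.
Proof.
move=> m srR idJ fc bc bJ; have [J0 JD JMl JMr] := idJ.
have {bJ} /choice[rs rsP] : forall i, exists rs : (nat -> R) * (nat -> R),
    J (1 - \sum_(l < n) rs.1 l * b i * rs.2 l).
  by move=> i; have [_ [r [s ->]] Jrs] := bJ i; exists (r, s).
pose A : 'M[R]_(m, n) := \matrix_(i, l) ((rs i).1 l * f i).
pose X : 'M[R]_(n, m) := \matrix_(l, j) (c j * (rs j).2 l).
apply: (@stable_rank_ideal R J idJ k n A X srR) => i j.
rewrite !mxE.
have -> : \sum_l A i l * X l j =
    \sum_(l < n) (rs i).1 l * (f i * c j) * (rs j).2 l.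
  by apply: eq_bigr => l _; rewrite !mxE !mulrA.
rewrite fc // -(inj_eq val_inj); case: eqVneq => [ij|_] /=; last first.
  by rewrite big1 ?subr0 // => l _; rewrite mulr0 mul0r.
rewrite !mulr1n -{}ij -opprB; apply: ideal_opp => //.
rewrite -[1](subrK (\sum_(l < n) (rs i).1 l * b i * (rs i).2 l)) -addrA.
apply: JD => //; rewrite -sumrB; apply: ideal_bigsum => // l _.
by rewrite -mulrBl -mulrBr; apply: JMr; apply: JMl; apply: bc.
Qed.

End SandwichSums.

(** * Countability in omega_1 and elements of the semilattice *)

Section Omega1.
Variables (d : Order.disp_t) (W : omega1Type d).

(** Otherwise omega_1 would be a union of countably many countable closed initial segments. *)
Lemma omega1_above (u : nat -> W) : exists a, forall n, (u n < a)%O.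
Proof.
apply: contrapT => nu; apply: (@omega1_uncountable _ W).
apply: (@sub_countable _ _ _ (\bigcup_n (segment (u n) `|` [set u n]))); last first.
  apply: bigcup_countable => // n _; rewrite -bigcup2E.
  apply: bigcup_countable => // -[|[|i]] _ //=; exact: omega1_countable_segment.
apply: subset_card_le => a _; apply: contrapT => na; apply: nu.
exists a => n; rewrite ltNge; apply/negP; rewrite le_eqVlt => /orP[/eqP aE|au].
  by apply: na; exists n => //; right.
by apply: na; exists n => //; left.
Qed.

(** If all fibres of [n] were finite, omega_1 would be countable; an infinite fibre contains an
    injective sequence. *)
Lemma omega1_pigeonhole (n : W -> nat) :
  exists N (u : nat -> W), injective u /\ forall i, n (u i) = N.
Proof.
have [N /infiniteP/card_leP/injfunPex[h _ hI]] : exists N, infinite_set (n @^-1` [set N]).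
  apply: contrapT => nN; apply: (@omega1_uncountable _ W).
  apply: (@sub_countable _ _ _ (\bigcup_N (n @^-1` [set N]))).
    by apply: subset_card_le => a _; exists (n a).
  apply: bigcup_countable => // N _; apply: finite_set_countable.
  by apply: contrapT => fN; apply: nN; exists N.
exists N, (fun i => val (h (exist _ i (mem_set I)))); split.
  by move=> i j /val_inj /(hI _ _ (mem_set I) (mem_set I)) [].
by move=> i; apply: (set_mem (valP (h _))).
Qed.

Lemma F_omega1_setT (a : W) : F_omega1 [set: W].
Proof.
have [B0 BC _] := B_omega1_algebra W.
by split; [rewrite -setC0; apply: BC | exists a].
Qed.

Lemma F_omega1_setCsegment (a : W) : F_omega1 (~` segment a).
Proof.
have [_ BC _] := B_omega1_algebra W; split; last by exists a.
apply: BC; apply: sub_gen_smallest; exists `]-oo, a[.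
by apply/seteqP; split=> b; rewrite /segment /= in_itv.
Qed.

Lemma F_omega1_setC1 (a : W) : F_omega1 (~` [set a]).
Proof.
have [_ BC _] := B_omega1_algebra W; split.
  apply: BC; apply: sub_gen_smallest; exists `[a, a].
  by rewrite set_itv1.
have [b ab] := omega1_above (fun=> a); exists b => c /= + ca; apply.
by rewrite ca; apply: (ab 0%N).
Qed.

Definition S_omega1_upper (D F : set W) (hD : Dminus_omega1 D)
    (hF : F_omega1 F) : S_omega1 W :=
  exist _ (D, F) (mem_set (or_intror (conj hD hF))).

Lemma S_omega1_leP (p q : S_omega1 W) :
  reflect ((val p).1 `<=` (val q).1 /\ (val p).2 `<=` (val q).2) (p <= q)%O.
Proof. exact: asboolP. Qed.

(** [Dminus_omega1] excludes the empty set, so the second component must come from [I_omega1]. *)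
Lemma S_omega1_bounded (p : S_omega1 W) :
  (val p).1 = set0 -> exists a, (val p).2 `<=` segment a.
Proof.
case: p => -[D F] /= h D0; move: (set_mem h) => [[_ [_]] //|[[_ /(_ D0)]]].
by [].
Qed.

End Omega1.

(** * Transfer between the semilattice order and ideals *)

Section Isomorphism.
Variables (d : Order.disp_t) (W : omega1Type d) (R : pzRingType).
Variable f : S_omega1 W -> compact_ideal R.
Hypotheses (fbij : bijective f) (fU : {morph f : x y / (x `|` y)%O}).

Local Notation K p := (val (f p)).

Lemma iso_subset p q : K p `<=` K q <-> (p <= q)%O.
Proof.
have <- : (f p <= f q)%O = (p <= q)%O.
  by rewrite !leEjoin -fU (inj_eq (bij_inj fbij)).
by split=> [h|/asboolP //]; apply/asboolP.
Qed.

Lemma iso_surj I : is_compact_ideal I -> exists p, K p = I.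
Proof.
by move=> cI; case: fbij => g _ gK; exists (g (exist _ I (mem_set cI))); rewrite gK.
Qed.

Lemma iso_join p q r : (r <= p `|` q)%O -> K r `<=` ideal_sum (K p) (K q).
Proof. by move=> /iso_subset; rewrite fU. Qed.

(** The unit ideal is compact, hence the image of some element, which lies below [p]. *)
Lemma iso_top p : (forall q, (q <= p)%O) -> K p 1.
Proof.
move=> pT; have [q qE] : exists q, K q = ideal_span [set` [:: 1 : R]].
  by apply: iso_surj; exists [:: 1].
have /iso_subset qp := pT q; apply: qp.
by rewrite qE; apply: sub_gen_smallest; apply: mem_head.
Qed.

Lemma iso_one p q : K p 1 -> (q <= p)%O.
Proof.
move=> p1; apply/iso_subset => x _; rewrite -[x]mulr1.
by have [_ _ Ml _] := compact_ideal_ideal (f p); apply: Ml.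
Qed.

End Isomorphism.

(** * Assembling the contradiction *)

Theorem corollary6p1 (d : Order.disp_t) (W : omega1Type d) (R : pzRingType)
    (regR : von_neumann_regular R) (srR : finite_stable_rank R) :
  ~ isomorphic_semilattices (S_omega1 W) (compact_ideal R).
Proof.
move=> [f [fbij _ fU]]; have [k _ srk] := srR.
pose K p : set R := val (f p).
have idK p : two_sided_ideal (K p) := compact_ideal_ideal (f p).
(* The constant map serves only to produce a point [a0] of omega_1. *)
have [_ [u0 _]] := omega1_pigeonhole (fun _ : W => 0%N).
pose a0 := u0 0%N.
have DT : Dminus_omega1 [set: W].
  by split; [right | apply/eqP/set0P; exists a0].
have Dfin (D : set W) : finite_set D -> D !=set0 -> Dminus_omega1 D.
  by move=> fD /set0P/eqP D0; split; [left|].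
pose top := S_omega1_upper DT (F_omega1_setT a0).
pose pt (x : W) :=
  S_omega1_upper (Dfin [set x] (finite_set1 x) (ex_intro _ x erefl)) (F_omega1_setT a0).
pose tail a := S_omega1_upper DT (F_omega1_setCsegment a).
pose co1 a := S_omega1_upper DT (F_omega1_setC1 a).
have topP p : (p <= top)%O by apply/S_omega1_leP; split.
have K1 : K top 1 by apply: iso_top.
have K1F a : ~ K (co1 a) 1.
  move=> /(iso_one fbij fU top) /S_omega1_leP[_ /(_ a I)] /=; exact.
have Ktail x a : ideal_sum (K (pt x)) (K (tail a)) 1.
  apply: (iso_join fbij fU (r := top)) K1; apply/S_omega1_leP; split=> /= b _.
    by right.
  by left.
have tail_co1 a b : (b < a)%O -> K (tail a) `<=` K (co1 b).
  move=> ba; apply/(iso_subset fbij fU)/S_omega1_leP; split=> //= c ca cb.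
  by apply: ca; rewrite cb.
have /choice[g gE] x : exists g, K (pt x) = ideal_span [set g].
  by apply: compact_ideal_principal => //; apply: compact_idealP.
have /choice[n nP] x : exists n, forall a,
    exists2 z, sandwich_sum (g x) n z & K (co1 a) (1 - z).
  (* If each [n] fails at some point [u n], take [a] above all of them: a decomposition of [1]
     modulo [K (tail a)] has some number [m] of terms and contradicts the failure at [u m]. *)
  apply: contrapT => nn.
  have /choice[u uP] n : exists a,
      ~ exists2 z, sandwich_sum (g x) n z & K (co1 a) (1 - z).
    by apply: contrapT => na; apply: nn; exists n => a; apply: contrapT => ?; apply: na; exists a.
  have [a ua] := omega1_above u.
  have [z [t [+ Kt zt]]] := Ktail x a; rewrite gE => /ideal_span1_sandwich[m zm].
  apply: (uP m); exists z => //; apply: tail_co1 (ua m) _ _.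
  by rewrite zt addrC addKr.
have [N [u [uinj uN]]] := omega1_pigeonhole n.
pose b i := g (u i); pose m := iter N (addn k) 1%N.
have [h [c [hc bc]]] := orthogonalization regR b m.
(* Besides the [u j] with [j < i], the point [u i.+1] is included to keep [D i] nonempty for
   [i = 0]; [u i] stays outside. *)
pose D i : set W := u @` [set j | (j <= i.+1)%N && (j != i)].
have DP i : Dminus_omega1 (D i).
  apply: (Dfin); last by exists (u i.+1), i.+1 => //=; rewrite leqnn gtn_eqF.
  apply: finite_image; apply: (sub_finite_set _ (finite_II i.+2)) => j /=.
  by rewrite ltnS => /andP[].
(* The guard [i < m] allows a default bound at the other indices, so that [omega1_above] applies to
   the whole sequence [v]. *)
have /choice[v vP] i : exists a, (i < m)%N ->
    forall e, (a <= e)%O -> K (co1 e) (b i - c i).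
  have [im|_] := ltnP i m; last by exists a0.
  pose q := S_omega1_upper (DP i) (F_omega1_setT a0).
  have [p pE] : exists p, K p = ideal_span [set` [:: b i - c i]].
    by apply: (iso_surj fbij); exists [:: b i - c i].
  have pK r : K r (b i - c i) -> (p <= r)%O.
    move=> Kr; apply/(iso_subset fbij fU); rewrite -/(K p) pE.
    by apply: (ideal_span_sub (idK r)) => x /=; rewrite inE => /eqP->.
  have gK j : K (pt (u j)) (b j) by rewrite gE; apply: sub_gen_smallest.
  (* Applying [bc] to the ideals of [pt (u i)] and of [q] confines the first component of [p] to the
     disjoint sets [[set u i]] and [D i], so it is empty. *)
  have /S_omega1_leP[/= p1 _] : (p <= pt (u i))%O by apply: (pK); apply: bc => //; left.
  have /S_omega1_leP[/= p2 _] : (p <= q)%O.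
    apply: (pK); apply: bc => //; right=> j ji.
    suff : K (pt (u j)) `<=` K q by apply.
    apply/(iso_subset fbij fU)/S_omega1_leP; split=> //= _ ->.
    by exists j => //; apply/andP; split; [apply/leqW/ltnW | rewrite ltn_eqF].
  have [|a pa] := @S_omega1_bounded _ _ p.
    rewrite -subset0 => x px; have [j /andP[_ ji] xE] := p2 x px.
    by move: (p1 x px) ji; rewrite -xE => /= /uinj ->; rewrite eqxx.
  exists a => _ e ae.
  suff : K p `<=` K (co1 e).
    by apply; rewrite pE; apply: sub_gen_smallest; apply: mem_head.
  apply/(iso_subset fbij fU)/S_omega1_leP; split=> //= x /pa xa xe.
  by move: xa; rewrite xe /segment /= ltNge ae.
have [e ve] := omega1_above v.
apply: (K1F e); apply: (stable_rank_orthogonal srk (idK _) hc).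
  by move=> i im; apply: vP => //; apply: ltW.
by move=> i; rewrite -(uN i); apply: nP.
Qed.
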